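(* For $s \ge 0$ and $i\ge 1$ let $p_{i,s}$ be the number of stones in pit $i$ in the unique winning Tchoukaillon position with a total of $s$ stones. For all $i \ge 1$, the sequence of $i$-tuples $$\big((p_{1,s}, p_{2,s}, \ldots, p_{i,s})\big)_{s \ge 0}$$ is periodic of (least) period $\operatorname{lcm}(1,2,3,\ldots,i+1)$.
   Context: **Tchoukaillon.** This is a solitaire game on a row of pits numbered $1, 2, 3, \ldots$ (here an unlimited number of pits, only finitely many of which are non-empty), each containing some number of stones, together with an additional pit, the Roumba, which may be regarded as pit $0$. A move consists of harvesting a pit $i$. Pit $i$ may be harvested if and only if it contains exactly $i$ stones ($i \ge 1$). Its $i$ stones are removed and one stone is placed in each of the pits $i-1, i-2, \ldots, 1$ and one in the Roumba. The game is won if all stones have been put in the Roumba. A winning position is a position from which a win is possible (the empty position is winning). For every $s \ge 0$ there is exactly one winning position with a total of $s$ stones in the pits. *)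

(* Defs.v *)
From mathcomp Require Import all_boot finmap.
From mathcomp Require Import zify.

Set Implicit Arguments.
Unset Strict Implicit.
Unset Printing Implicit Defensive.

(* Pit 0 is the Roumba; the pits proper are 1, 2, 3, ... *)
Definition position := {fsfun nat -> nat with 0}.

Definition stones (p : position) : nat :=
  \sum_(i <- finsupp p | 0 < i) p i.

(* [harvest i p q]: pit [i] may be harvested in [p], and doing so yields [q]. *)
Definition harvest (i : nat) (p q : position) : Prop :=
  [/\ 0 < i, p i = i &
      forall j, q j = if j < i then (p j).+1 else if j == i then 0 else p j].

Definition won (p : position) : Prop := forall i, 0 < i -> p i = 0.

Inductive winning (p : position) : Prop :=
| winning_won of won p
| winning_harvest i q of harvest i p q & winning q.

Definition is_period (T : Type) (u : nat -> T) (d : nat) : Prop :=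
  0 < d /\ forall s, u (s + d) = u s.

Definition least_period (T : Type) (u : nat -> T) (d : nat) : Prop :=
  is_period u d /\ forall e, is_period u e -> d <= e.

Lemma stonesE (p : position) n :
  (forall i, n < i -> p i = 0) -> stones p = \sum_(1 <= i < n.+1) p i.
Proof.
move=> pn; rewrite /stones -big_filter.
rewrite [RHS](bigID (fun i => p i != 0)) /= [X in _ = _ + X]big1; last first.
  by move=> i /negPn/eqP.
rewrite addn0 -[RHS]big_filter; apply: perm_big; apply: uniq_perm.
- by rewrite filter_uniq // fset_uniq.
- by rewrite filter_uniq // iota_uniq.
move=> i; rewrite !mem_filter mem_index_iota mem_finsupp.
have [lt_ni|le_in] := ltnP n i; first by rewrite (pn i lt_ni) /= andbF.
by rewrite ltnS le_in andbT andbC.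
Qed.

Lemma finsupp_bound (p : position) : exists n, forall i, n < i -> p i = 0.
Proof.
exists (\max_(i <- finsupp p) i) => i; case: (finsuppP p i) => // ip.
by rewrite ltnNge (leq_bigmax_seq i).
Qed.

Lemma harvest_stones i (p q : position) :
  harvest i p q -> stones p = (stones q).+1.
Proof.
case=> i0 pi qE; have [n pn] := finsupp_bound p.
have le_in: i <= n by case: (leqP i n) => // /pn; lia.
rewrite (stonesE pn) (@stonesE q n); last first.
  by move=> j nj; rewrite qE !ifF ?pn //; lia.
have split_i F : \sum_(1 <= j < n.+1) F j =
    \sum_(1 <= j < i) F j + (F i + \sum_(i.+1 <= j < n.+1) F j).
  by rewrite (@big_cat_nat _ _ _ i) ?leqW //= (big_ltn (m := i)) ?ltnS.
rewrite !split_i.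
have -> : \sum_(1 <= j < i) q j = \sum_(1 <= j < i) p j + (i - 1).
  rewrite -[X in _ + X]muln1 -sum_nat_const_nat -big_split /=.
  by apply: eq_big_nat => j /andP[_ ji]; rewrite qE ji addn1.
have -> : \sum_(i.+1 <= j < n.+1) q j = \sum_(i.+1 <= j < n.+1) p j.
  by apply: eq_big_nat => j /andP[ij _]; rewrite qE !ifF //; lia.
by rewrite qE ltnn eqxx pi; lia.
Qed.

Lemma stones_eq0 (p : position) : stones p = 0 <-> won p.
Proof.
split=> [|pw]; last by rewrite /stones big1 // => i; exact: pw.
have [n pn] := finsupp_bound p; rewrite (stonesE pn) => /eqP.
rewrite sum_nat_seq_eq0 => /allP p0 i i0; case: (ltnP n i) => [/pn//|le_in].
by apply/eqP; apply: (p0 i); rewrite mem_index_iota i0 ltnS.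
Qed.

Lemma winning_exists s : exists p, winning p /\ stones p = s.
Proof.
suff /(_ 0) [p [? ? _]] : forall r,
    exists p : position, [/\ winning p, stones p = s & p 0 = r] by exists p.
elim: s => [|s IHs] r.
  pose p : position := [fsfun j in [fset 0%N]%fset => r]%fset.
  have pw : won p by move=> i i0; rewrite fsfunE in_fset1; case: i i0.
  exists p; split; [exact: winning_won|exact/stones_eq0|].
  by rewrite fsfunE in_fset1.
have [q [qwin qs q0]] := IHs r.+1; have [n qn] := finsupp_bound q.
have exi : exists i, (0 < i) && (q i == 0).
  by exists n.+1; rewrite qn ?eqxx.
case: (ex_minnP exi) => i /andP[i0 /eqP qi] imin.
have lti j : j < i -> 0 < q j.
  case: j => [|j] ji; first by rewrite q0.
  by rewrite lt0n; apply/negP => qj; have := imin j.+1 qj; lia.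
pose p : position := [fsfun j in (finsupp q `|` [fset i])%fset =>
  if j < i then (q j).-1 else if j == i then i else q j].
have pE j : p j = if j < i then (q j).-1 else if j == i then i else q j.
  rewrite fsfunE in_fsetU in_fset1; case: (finsuppP q j) => //=.
  by case: eqP => //=; case: ifP.
have hpq : harvest i p q.
  split=> [//||j]; first by rewrite pE ltnn eqxx.
  rewrite pE; case: (ltnP j i) => [/lti/prednK->//|_].
  by case: eqP => // ->.
exists p; split; first exact: winning_harvest hpq qwin.
- by rewrite (harvest_stones hpq) qs.
- by rewrite pE i0 q0.
Qed.

Lemma winning_unique (p q : position) : winning p -> winning q ->
  stones p = stones q -> forall i, 0 < i -> p i = q i.
Proof.
move=> pwin; elim: pwin q => {p} [p pw q _|p a p' hp _ IH q].
  by rewrite (proj2 (stones_eq0 p) pw) => /esym/stones_eq0 qw i i0; rewrite pw ?qw.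
case=> [qw|b q' hq q'win].
  by rewrite (proj2 (stones_eq0 q) qw) (harvest_stones hp).
rewrite (harvest_stones hp) (harvest_stones hq) => -[] /(IH _ q'win) pq'.
have [a0 pa p'E] := hp; have [b0 qb q'E] := hq.
have ab : a = b.
  apply/eqP; rewrite eqn_leq; apply/andP; split; rewrite leqNgt; apply/negP => lt.
    by have := pq' b b0; rewrite p'E q'E lt ltnn eqxx.
  by have := pq' a a0; rewrite p'E q'E lt ltnn eqxx.
subst b => i i0; have := pq' i i0; rewrite p'E q'E.
by case: ifP => [_ []//|_]; case: eqP => // ->; rewrite pa qb.
Qed.

(* Main.v *)
Require Import Defs.
From mathcomp Require Import all_boot finmap.
From mathcomp Require Import zify.

Set Implicit Arguments.
Unset Strict Implicit.
Unset Printing Implicit Defensive.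

(** Fix a win from a position [p], and let [H j] be the number of its moves that
    harvest a pit beyond [j].  Since every move puts one stone in the Roumba,
    [H 0] is the number of stones.  Pit [j >= 1] receives a stone from each of
    the [H j] harvests beyond it, loses [j] stones in each of its own
    [H (j - 1) - H j] harvests, and ends empty, so
    [p j + (j + 1) * H j = j * H (j - 1)].  In a winning position [p j <= j], so
    this is a Euclidean division by [j + 1]: the number of stones alone
    determines all [H j] and all [p j] ([winning_pitE]).

    Now replace [s] by [s + d].  If [j] divides [d] and [H (j - 1)] grows by
    [d / j], then the dividend [j * H (j - 1)] grows by exactly [d].  Hence the
    remainder [p j] is unchanged if and only if [j + 1] divides [d], and in that
    case the quotient [H j] grows by [d / (j + 1)], which is the assumption for
    the next pit.  So [d] is a period of the first [i] pits if and only if all of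
    [1, ..., i + 1] divide [d] ([pits_periodic_dvd], [dvd_pit_periodic]), and the
    least such [d > 0] is their least common multiple. *)

(** The number of harvests beyond pit [j] in a win of the [s]-stone position. *)
Fixpoint harvests_beyond (s j : nat) : nat :=
  if j is k.+1 then (k.+1 * harvests_beyond s k) %/ k.+2 else s.

(** The stone balance of each pit over a win, together with the bound that makes
    it a Euclidean division.  The bound survives because undoing a harvest only
    removes stones from pits, except that it refills pit [a] to exactly [a]. *)
Lemma winning_balance (p : position) : winning p ->
  exists H : nat -> nat, H 0 = stones p /\
    forall j, p j.+1 <= j.+1 /\ p j.+1 + j.+2 * H j.+1 = j.+1 * H j.
Proof.
elim=> {p} [p pw|p a q hpq _ [H [H0 HE]]].
  exists (fun=> 0); split; first by rewrite (proj2 (stones_eq0 p) pw).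
  by move=> j; rewrite pw // !muln0.
(* The first move, at pit [a], lies beyond exactly the pits below [a]. *)
exists (fun j => H j + (j < a)).
have [a0 pa qE] := hpq; split; first by rewrite (harvest_stones hpq) H0 a0 addn1.
move=> j; have [] := HE j; rewrite qE.
by case: (ltngtP j.+1 a) => [_|_|->] /=; rewrite ?pa; lia.
Qed.

Lemma winning_pitE (p : position) j : winning p ->
  p j.+1 = (j.+1 * harvests_beyond (stones p) j) %% j.+2.
Proof.
move=> /winning_balance[H [H0 HE]].
suff <- : H j = harvests_beyond (stones p) j.
  by have [le_pj <-] := HE j; rewrite addnC mulnC modnMDl modn_small.
elim: j => [//|j IHj] /=; rewrite -IHj.
by have [le_pj <-] := HE j; rewrite addnC mulnC divnMDl // divn_small // addn0.
Qed.

(** One division step of the shift by [d]: the dividend for pit [j + 1] grows by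
    [d] itself, whatever [j] is, which is what lets the divisors accumulate. *)
Lemma mul_harvests_beyond_shift s d j :
    j.+1 %| d -> harvests_beyond (s + d) j = harvests_beyond s j + d %/ j.+1 ->
  j.+1 * harvests_beyond (s + d) j = j.+1 * harvests_beyond s j + d.
Proof. by move=> dvd ->; rewrite mulnDr [X in _ + X]mulnC divnK. Qed.

Lemma harvests_beyond_shift s d j : (forall k, k <= j -> k.+1 %| d) ->
  harvests_beyond (s + d) j = harvests_beyond s j + d %/ j.+1.
Proof.
elim: j => [|j IHj] dvd /=; first by rewrite divn1.
have shift := IHj (fun k le_kj => dvd k (leqW le_kj)).
by rewrite (mul_harvests_beyond_shift (dvd j (leqnSn j)) shift) divnDr ?dvd.
Qed.

Lemma winning_sequence_pitE (p : nat -> position) s j :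
    (forall s, winning (p s) /\ stones (p s) = s) ->
  p s j.+1 = (j.+1 * harvests_beyond s j) %% j.+2.
Proof. by move=> hp; have [/winning_pitE-> ->] := hp s. Qed.

Lemma dvd_pit_periodic (p : nat -> position) d j s :
    (forall s, winning (p s) /\ stones (p s) = s) ->
    (forall k, k <= j.+1 -> k.+1 %| d) ->
  p (s + d) j.+1 = p s j.+1.
Proof.
move=> hp dvd; rewrite !(winning_sequence_pitE _ _ hp).
have shift := harvests_beyond_shift s (fun k le_kj => dvd k (leqW le_kj)).
rewrite (mul_harvests_beyond_shift _ shift) ?dvd //.
by rewrite -modnDmr (eqP (dvd j.+1 _)) ?addn0.
Qed.

(** Pit by pit, from the Roumba outwards: the growth of the dividend for a pit is
    known only once the smaller divisors have been obtained from earlier pits. *)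
Lemma pits_periodic_dvd (p : nat -> position) d i :
    (forall s, winning (p s) /\ stones (p s) = s) ->
    (forall j, j < i -> forall s, p (s + d) j.+1 = p s j.+1) ->
  forall k, k <= i -> k.+1 %| d.
Proof.
move=> hp; elim: i => [|i IHi] per k.
  by rewrite leqn0 => /eqP->; rewrite dvd1n.
have dvd := IHi (fun j lt_ji => per j (leqW lt_ji)).
rewrite leq_eqVlt ltnS => /predU1P[->|]; last exact: dvd.
(* Divisibility by [1, ..., i + 1] makes the dividend for pit [i + 1] grow by
   [d], so one unchanged remainder, here at [s = 0], makes [i + 2] divide [d]. *)
have := per i (ltnSn i) 0.
have shift := harvests_beyond_shift 0 dvd.
rewrite !(winning_sequence_pitE _ _ hp).
rewrite (mul_harvests_beyond_shift (dvd i (leqnn i)) shift) => /eqP.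
by rewrite -{2}[_ * _]addn0 eqn_modDl mod0n.
Qed.

Lemma dvdn_biglcm_nat n d :
  reflect (forall k, k < n -> k.+1 %| d) (\big[lcmn/1]_(1 <= k < n.+1) k %| d).
Proof.
elim: n => [|n IHn]; first by rewrite big_geq // dvd1n; apply: ReflectT.
rewrite big_nat_recr //= dvdn_lcm; apply: (iffP andP) => [[/IHn dvd dvdn] k|dvd].
  by rewrite ltnS leq_eqVlt => /predU1P[->|/dvd].
by split; [apply/IHn => k lt_kn; apply: dvd; apply: leqW | apply: dvd].
Qed.

Theorem proposition6 (p : nat -> position)
    (hp : forall s : nat, winning (p s) /\ stones (p s) = s)
    (i : nat) (hi : 0 < i) :
  least_period (fun s : nat => [tuple p s j.+1 | j < i])
    (\big[lcmn/1]_(1 <= k < i.+2) k).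
Proof.
split=> [|e [e_gt0 per]]; last first.
  apply: dvdn_leq => //; apply/dvdn_biglcm_nat => k; rewrite ltnS; move: k.
  apply: (pits_periodic_dvd hp) => j lt_ji s.
  have /(congr1 (fun t : i.-tuple nat => tnth t (Ordinal lt_ji))) := per s.
  by rewrite !tnth_mktuple.
split=> [|s].
  by rewrite big_seq; elim/big_ind: _ => // [m n m0 n0|k];
     [rewrite lcmn_gt0 m0 | rewrite mem_index_iota => /andP[]].
apply: eq_from_tnth => j; rewrite !tnth_mktuple.
apply: (dvd_pit_periodic _ hp) => k le_kj.
by apply: (dvdn_biglcm_nat _ _ (dvdnn _)); have := ltn_ord j; lia.
Qed.
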